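(* Let $\mathcal{G}$ be any class of graphs and let $\overline{L(\mathcal{G})}$ denote the class of all graphs $\overline{L(G)}$ with $G\in\mathcal{G}$. Then the following statements are equivalent. (1) The class $\overline{L(\mathcal{G})}$ is $(\mathrm{tw},\omega)$-bounded. (2) The class $\overline{L(\mathcal{G})}$ has bounded tree-independence number. (3) There exists a positive integer $s$ such that every graph in $\overline{L(\mathcal{G})}$ is $K_{s,s}$-free. (4) There exists a positive integer $s$ such that every graph in $\overline{L(\mathcal{G})}$ has a vertex cover inducing a subgraph with independence number at most $s$. (5) There exists a positive integer $s$ such that every graph in $\mathcal{G}$ is $2K_{1,s}$-subgraph-free.
   Context: All graphs are finite, simple and undirected. $L(G)$ is the line graph of $G$ and $\overline{H}$ denotes the complement of $H$. A graph is $H$-free if it has no induced subgraph isomorphic to $H$, and $H$-subgraph-free if it has no (not necessarily induced) subgraph isomorphic to $H$. $2K_{1,s}$ is the disjoint union of two copies of the star $K_{1,s}$. A vertex cover is a set of vertices containing at least one endpoint of every edge. A tree decomposition of $G$ is a pair $(T,\{X_t\}_{t\in V(T)})$ with $T$ a tree and bags $X_t\subseteq V(G)$ such that every vertex lies in some bag, every edge has both endpoints in some bag, and for each vertex $v$ the nodes whose bags contain $v$ induce a connected subtree. Its independence number is $\max_t \alpha(G[X_t])$; the tree-independence number $\mathsf{tree}\text{-}\alpha(G)$ is the minimum independence number over all tree decompositions of $G$; $\mathrm{tw}(G)$ is the treewidth and $\omega(G)$ the clique number. A graph class $\mathcal{C}$ is $(\mathrm{tw},\omega)$-bounded if there is a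 function $f:\mathbb{N}\to\mathbb{N}$ such that for every $G\in\mathcal{C}$ and every induced subgraph $G'$ of $G$, $\mathrm{tw}(G')\le f(\omega(G'))$. A class has bounded tree-independence number if there is a constant bounding $\mathsf{tree}\text{-}\alpha$ of all its members. *)

(* Defs.v *)
From HB Require Import structures.
From mathcomp Require Import all_boot.
From mathcomp Require Import boolp.

Set Implicit Arguments.
Unset Strict Implicit.
Unset Printing Implicit Defensive.

Record sgraph := SGraph {
  vertex :> finType;
  adj : rel vertex;
  adj_sym : symmetric adj;
  adj_irrefl : irreflexive adj }.

Arguments adj {s} _ _.

Definition graph_class := sgraph -> Prop.

Definition iso (G H : sgraph) : Prop :=
  exists f : G -> H, bijective f /\ forall x y, adj (f x) (f y) = adj x y.

Section Induced.
Variables (G : sgraph) (X : {set G}).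

Definition induced_adj : rel {x : G | x \in X} :=
  fun x y => adj (val x) (val y).

Fact induced_sym : symmetric induced_adj.
Proof. by move=> x y; apply: adj_sym. Qed.

Fact induced_irrefl : irreflexive induced_adj.
Proof. by move=> x; apply: adj_irrefl. Qed.

Definition induced : sgraph := SGraph induced_sym induced_irrefl.

End Induced.

(* A not necessarily induced subgraph: a vertex set together with a set of
   edges of G, given as a symmetric relation, joining vertices of that set. *)
Record subgraph (G : sgraph) := Subgraph {
  sub_verts : {set G};
  sub_adj : rel G;
  sub_adj_sym : symmetric sub_adj;
  sub_adjP : forall x y, sub_adj x y ->
    [/\ x \in sub_verts, y \in sub_verts & adj x y] }.

Section SubgraphGraph.
Variables (G : sgraph) (S : subgraph G).

Definition subgraph_adj : rel {x : G | x \in sub_verts S} :=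
  fun x y => sub_adj S (val x) (val y).

Fact subgraph_sym : symmetric subgraph_adj.
Proof. by move=> x y; apply: sub_adj_sym. Qed.

Fact subgraph_irrefl : irreflexive subgraph_adj.
Proof. by move=> x; apply/negP => /sub_adjP[_ _]; rewrite adj_irrefl. Qed.

Definition subgraph_graph : sgraph := SGraph subgraph_sym subgraph_irrefl.

End SubgraphGraph.

Definition free (H G : sgraph) : Prop :=
  ~ exists X : {set G}, iso (induced X) H.

Definition subgraph_free (H G : sgraph) : Prop :=
  ~ exists S : subgraph G, iso (subgraph_graph S) H.

Section Complement.
Variable G : sgraph.

Definition compl_adj : rel G := fun x y => (x != y) && ~~ adj x y.

Fact compl_sym : symmetric compl_adj.
Proof. by move=> x y; rewrite /compl_adj eq_sym adj_sym. Qed.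

Fact compl_irrefl : irreflexive compl_adj.
Proof. by move=> x; rewrite /compl_adj eqxx. Qed.

Definition complement : sgraph := SGraph compl_sym compl_irrefl.

End Complement.

Section LineGraph.
Variable G : sgraph.

Definition edge_set : {set {set G}} :=
  [set e : {set G} | [exists x, exists y, adj x y && (e == [set x; y])]].

Definition line_adj : rel {e : {set G} | e \in edge_set} :=
  fun e f => (e != f) && (val e :&: val f != set0).

Fact line_sym : symmetric line_adj.
Proof. by move=> e f; rewrite /line_adj eq_sym setIC. Qed.

Fact line_irrefl : irreflexive line_adj.
Proof. by move=> e; rewrite /line_adj eqxx. Qed.

Definition line_graph : sgraph := SGraph line_sym line_irrefl.

End LineGraph.

Definition co_line_class (C : graph_class) : graph_class :=
  fun H => exists G, C G /\ H = complement (line_graph G).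

Section CompleteBipartite.
Variables m n : nat.

Definition bip_adj : rel ('I_m + 'I_n)%type := fun x y =>
  match x, y with
  | inl _, inr _ | inr _, inl _ => true
  | _, _ => false
  end.

Fact bip_sym : symmetric bip_adj.
Proof. by move=> [?|?] [?|?]. Qed.

Fact bip_irrefl : irreflexive bip_adj.
Proof. by case. Qed.

Definition complete_bipartite : sgraph := SGraph bip_sym bip_irrefl.

End CompleteBipartite.

Section DisjointUnion.
Variables G H : sgraph.

Definition union_adj : rel (G + H)%type := fun x y =>
  match x, y with
  | inl a, inl b => adj a b
  | inr a, inr b => adj a b
  | _, _ => false
  end.

Fact union_sym : symmetric union_adj.
Proof. by move=> [?|?] [?|?] //=; apply: adj_sym. Qed.

Fact union_irrefl : irreflexive union_adj.
Proof. by move=> [?|?] /=; apply: adj_irrefl. Qed.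

Definition disjoint_union : sgraph := SGraph union_sym union_irrefl.

End DisjointUnion.

Definition star (s : nat) : sgraph := complete_bipartite 1 s.

Definition two_stars (s : nat) : sgraph := disjoint_union (star s) (star s).

Definition clique (G : sgraph) (A : {set G}) : bool :=
  [forall x in A, forall y in A, (x != y) ==> adj x y].

Definition independent (G : sgraph) (A : {set G}) : bool :=
  [forall x in A, forall y in A, ~~ adj x y].

Definition clique_number (G : sgraph) : nat :=
  \max_(A : {set G} | clique A) #|A|.

Definition independence_number (G : sgraph) : nat :=
  \max_(A : {set G} | independent A) #|A|.

Definition vertex_cover (G : sgraph) (X : {set G}) : Prop :=
  forall x y : G, adj x y -> x \in X \/ y \in X.

Definition connected (G : sgraph) : Prop :=
  forall x y : G, connect adj x y.

Definition acyclic (G : sgraph) : Prop :=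
  forall c : seq G, 2 < size c -> ~ ucycle adj c.

Definition is_tree (T : sgraph) : Prop :=
  [/\ 0 < #|T|, connected T & acyclic T].

Record tree_decomposition (G : sgraph) := TreeDecomposition {
  td_tree : sgraph;
  td_bag : td_tree -> {set G};
  td_treeP : is_tree td_tree;
  td_vertexP : forall v : G, exists t, v \in td_bag t;
  td_edgeP : forall u v : G, adj u v ->
    exists t, u \in td_bag t /\ v \in td_bag t;
  td_connectedP : forall v : G,
    connected (induced [set t | v \in td_bag t]) }.

Arguments td_bag {G} _ _.

(* On the null graph the width is 0, as the predecessor is truncated. *)
Definition td_width (G : sgraph) (D : tree_decomposition G) : nat :=
  (\max_(t : td_tree D) #|td_bag D t|).-1.

Definition td_independence (G : sgraph) (D : tree_decomposition G) : nat :=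
  \max_(t : td_tree D) independence_number (induced (td_bag D t)).

Section TrivialDecomposition.
Variable G : sgraph.

Definition point_graph : sgraph :=
  @SGraph unit (fun _ _ => false) (fun _ _ => erefl) (fun _ => erefl).

Fact point_tree : is_tree point_graph.
Proof.
split; first by rewrite card_unit.
- by move=> [] []; apply: connect0.
- by move=> [|[] [|[] c]].
Qed.

Fact point_connected (X : {set point_graph}) : connected (induced X).
Proof.
move=> x y; suff -> : x = y by apply: connect0.
by apply: val_inj; case: (val x); case: (val y).
Qed.

Definition trivial_decomposition : tree_decomposition G.
Proof.
apply: (@TreeDecomposition G point_graph (fun=> [set: G]) point_tree).
- by move=> v; exists tt; rewrite inE.
- by move=> u v _; exists tt; rewrite !inE.
- by move=> v; apply: point_connected.
Defined.

Fact ex_td_width :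
  exists k, `[< exists D : tree_decomposition G, td_width D = k >].
Proof.
by exists (td_width trivial_decomposition); apply/asboolP;
   exists trivial_decomposition.
Qed.

Fact ex_td_independence :
  exists k, `[< exists D : tree_decomposition G, td_independence D = k >].
Proof.
by exists (td_independence trivial_decomposition); apply/asboolP;
   exists trivial_decomposition.
Qed.

End TrivialDecomposition.

Definition treewidth (G : sgraph) : nat := ex_minn (ex_td_width G).

Definition tree_independence_number (G : sgraph) : nat :=
  ex_minn (ex_td_independence G).

Definition tw_omega_bounded (C : graph_class) : Prop :=
  exists f : nat -> nat, forall G : sgraph, C G -> forall X : {set G},
    treewidth (induced X) <= f (clique_number (induced X)).

Definition bounded_tree_independence (C : graph_class) : Prop :=
  exists k : nat, forall G : sgraph, C G -> tree_independence_number G <= k.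

(* Main.v *)
Require Import Defs.
From HB Require Import structures.
From mathcomp Require Import all_boot.
From mathcomp Require Import boolp.
From mathcomp Require Import zify.

Set Implicit Arguments.
Unset Strict Implicit.
Unset Printing Implicit Defensive.

(** (1) => (3): K_{s,s} has clique number at most 2, and every tree decomposition
    of it has a bag containing one whole side.
    (2) => (1): by Ramsey, a bag with bounded independence number and bounded
    clique number has bounded size.
    (3) => (5): the edges of a subgraph 2K_{1,s} of G induce a K_{s,s} in the
    complement of L(G).
    (5) => (4): let v have maximum degree in G.  A vertex of degree greater than
    2s in G - v would give two disjoint stars K_{1,s}, centred at it and at v.
    The edges avoiding v form a vertex cover of the complement of L(G), since
    those at v pairwise meet; a set of pairwise meeting edges avoiding v consists
    of edges at one of the two ends of any fixed member, so has size at most 4s.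
    (4) => (2): if X is a vertex cover, the star with central bag X and leaf bags
    X + v is a tree decomposition. *)

(** * Copies of a graph as injective maps *)

Lemma iso_of_embedding (H K : sgraph) (g : H -> K) :
  injective g -> #|K| <= #|H| ->
  (forall x y, adj (g x) (g y) = adj x y) -> iso K H.
Proof.
move=> g_inj leKH gE; have [f fK gK] := inj_card_bij g_inj leKH.
by exists f; split=> [|x y]; [exists g | rewrite -gE !gK].
Qed.

Lemma ex_induced_iso (H G : sgraph) :
  (exists X : {set G}, iso (induced X) H) <->
  exists2 h : H -> G, injective h & forall x y, adj (h x) (h y) = adj x y.
Proof.
split=> [[X [f [[g fK gK] fE]]]|[h h_inj hE]].
  exists (val \o g) => [|x y /=]; first exact: inj_comp val_inj (can_inj gK).
  by rewrite -[in RHS](gK x) -[in RHS](gK y) fE.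
have hX x : h x \in h @: setT by apply: imset_f; rewrite inE.
exists (h @: setT).
apply: (@iso_of_embedding H (induced (h @: setT)) (fun x => exist _ (h x) (hX x))).
- by move=> x y /(congr1 val) /h_inj.
- by rewrite card_sig card_imset // cardsT.
- by move=> x y; rewrite -hE.
Qed.

Lemma ex_subgraph_iso (H G : sgraph) :
  (exists S : subgraph G, iso (subgraph_graph S) H) <->
  exists2 h : H -> G, injective h & forall x y, adj x y -> adj (h x) (h y).
Proof.
split=> [[S [f [[g fK gK] fE]]]|[h h_inj hE]].
  exists (val \o g) => [|x y]; first exact: inj_comp val_inj (can_inj gK).
  by rewrite -{1}(gK x) -{1}(gK y) fE => /sub_adjP[].
(* Only images of edges of [H] are kept, so further edges of [G] among the image vertices do not
   spoil the isomorphism. *)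
pose r : rel G :=
  fun a b => [exists x, exists y, [&& adj x y, h x == a & h y == b]].
have rP a b : reflect (exists x y, [/\ adj x y, h x = a & h y = b]) (r a b).
  apply: (iffP existsP) => [[x /existsP[y /and3P[xy /eqP<- /eqP<-]]]|].
    by exists x, y.
  by move=> [x [y [xy <- <-]]]; exists x; apply/existsP; exists y; rewrite xy !eqxx.
have r_sym : symmetric r.
  by move=> a b; apply/rP/rP => -[x [y [xy <- <-]]]; exists y, x; rewrite adj_sym.
have hX x : h x \in h @: setT by apply: imset_f; rewrite inE.
have r_sub a b : r a b -> [/\ a \in h @: setT, b \in h @: setT & adj a b].
  by move=> /rP[x [y [xy <- <-]]]; rewrite !hX hE.
exists (Subgraph r_sym r_sub).
apply: (@iso_of_embedding H (subgraph_graph (Subgraph r_sym r_sub))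
  (fun x => exist _ (h x) (hX x))).
- by move=> x y /(congr1 val) /h_inj.
- by rewrite card_sig card_imset // cardsT.
- move=> x y; apply/rP/idP => [[x' [y' [xy /h_inj <- /h_inj <-]]] //|xy].
  by exists x, y.
Qed.

(** * Independent sets, cliques and graph parameters *)

Lemma independentP (G : sgraph) (A : {set G}) :
  reflect {in A &, forall x y, ~~ adj x y} (independent A).
Proof.
apply: (iffP forall_inP) => [AP x y xA yA|AP x xA]; first exact: (forall_inP (AP x xA)).
by apply/forall_inP => y; apply: AP.
Qed.

Lemma cliqueP (G : sgraph) (A : {set G}) :
  reflect {in A &, forall x y, x != y -> adj x y} (clique A).
Proof.
apply: (iffP forall_inP) => [AP x y xA yA|AP x xA].
  by move/forall_inP: (AP x xA) => /(_ y yA)/implyP.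
by apply/forall_inP => y yA; apply/implyP; apply: AP.
Qed.

Lemma card_val_imset (G : sgraph) (X : {set G}) (A : {set induced X}) :
  #|val @: A| = #|A|.
Proof. exact/card_imset/val_inj. Qed.

Lemma val_preimset (G : sgraph) (X A : {set G}) :
  A \subset X -> val @: [set x : induced X | val x \in A] = A.
Proof.
move=> /subsetP sAX; apply/setP => x; apply/imsetP/idP => [[y]|xA].
  by rewrite inE => ? ->.
by exists (exist _ x (sAX x xA)); rewrite ?inE.
Qed.

Lemma independence_induced_leP (G : sgraph) (X : {set G}) k :
  independence_number (induced X) <= k <->
  forall A : {set G}, A \subset X -> independent A -> #|A| <= k.
Proof.
split=> [/bigmax_leqP le_k A sAX /independentP indA|le_k].
  rewrite -(val_preimset sAX) card_val_imset; apply: le_k.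
  by apply/independentP => x y; rewrite !inE; apply: indA.
apply/bigmax_leqP => A /independentP indA; rewrite -card_val_imset.
apply: le_k; first by apply/subsetP => _ /imsetP[x _ ->]; apply: (valP x).
by apply/independentP => _ _ /imsetP[x xA ->] /imsetP[y yA ->]; apply: indA.
Qed.

Lemma card_clique_induced (G : sgraph) (X A : {set G}) :
  A \subset X -> clique A -> #|A| <= clique_number (induced X).
Proof.
move=> sAX /cliqueP clA; rewrite -(val_preimset sAX) card_val_imset.
apply: (@leq_bigmax_cond _ _ (fun B : {set induced X} => #|B|)).
by apply/cliqueP => x y; rewrite !inE => xA yA xy; apply: clA.
Qed.

Lemma treewidth_le (G : sgraph) (D : tree_decomposition G) :
  treewidth G <= td_width D.
Proof. by rewrite /treewidth; case: ex_minnP => m _; apply; apply/asboolP; exists D. Qed.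

Lemma ex_treewidth (G : sgraph) :
  exists D : tree_decomposition G, td_width D = treewidth G.
Proof. by rewrite /treewidth; case: ex_minnP => m /asboolP. Qed.

Lemma tree_independence_le (G : sgraph) (D : tree_decomposition G) :
  tree_independence_number G <= td_independence D.
Proof.
by rewrite /tree_independence_number; case: ex_minnP => m _; apply; apply/asboolP; exists D.
Qed.

Lemma ex_tree_independence (G : sgraph) :
  exists D : tree_decomposition G, td_independence D = tree_independence_number G.
Proof. by rewrite /tree_independence_number; case: ex_minnP => m /asboolP. Qed.

(** * A Ramsey bound *)

(** Induction on [k + w]: a vertex [v] of [S] has many neighbours or many non-neighbours in [S], and
    adding [v] enlarges the clique or the independent set found there. *)
Lemma ramsey (G : sgraph) k w (S : {set G}) : 2 ^ (k + w) <= #|S| ->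
  (exists A : {set G}, [/\ A \subset S, independent A & #|A| = k]) \/
  (exists A : {set G}, [/\ A \subset S, clique A & #|A| = w]).
Proof.
elim: {k w}(k + w) {-2}k {-2}w (erefl (k + w)) S => [|n IHn] [|k] [|w] //= kw S leS.
- by left; exists set0; split; rewrite ?sub0set ?cards0 //; apply/independentP => x y; rewrite inE.
- by left; exists set0; split; rewrite ?sub0set ?cards0 //; apply/independentP => x y; rewrite inE.
- by right; exists set0; split; rewrite ?sub0set ?cards0 //; apply/cliqueP => x y; rewrite inE.
have /card_gt0P[v vS] : 0 < #|S| by apply: leq_trans leS; rewrite expn_gt0.
pose N := [set u | adj v u].
have cardE : #|S| = (#|(S :\ v) :&: N| + #|(S :\ v) :\: N|).+1.
  by rewrite (cardsD1 v) vS cardsID.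
have [n1 n2] : k.+1 + w = n /\ k + w.+1 = n by lia.
rewrite kw expnS in leS.
(* Without [v] at least [2 * 2 ^ n - 1] vertices remain, so one of the two parts has [2 ^ n]. *)
have [leN|ltN] := leqP (2 ^ n) #|(S :\ v) :&: N|.
  rewrite -n1 in leN; case: (IHn k.+1 w n1 _ leN) => [[A [sA indA cA]]|[A [sA /cliqueP clA cA]]].
    by left; exists A; split=> //; apply: subset_trans sA _; apply/subsetP => x; rewrite !inE => /andP[/andP[]].
  right; exists (v |: A); split.
  - by rewrite subUset sub1set vS; apply: subset_trans sA _; apply/subsetP => x; rewrite !inE => /andP[/andP[]].
  - have vA x : x \in A -> adj v x by move/(subsetP sA); rewrite !inE => /andP[].
    apply/cliqueP => x y; rewrite !inE => /predU1P[->|xA] /predU1P[->|yA] //.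
    + by rewrite eqxx.
    + by rewrite vA.
    + by rewrite adj_sym vA.
    + exact: clA.
  - by rewrite cardsU1 cA; case: (boolP (v \in A)) => // /(subsetP sA); rewrite !inE eqxx.
have leM : 2 ^ n <= #|(S :\ v) :\: N| by lia.
rewrite -n2 in leM; case: (IHn k w.+1 n2 _ leM) => [[A [sA /independentP indA cA]]|[A [sA clA cA]]].
  left; exists (v |: A); split.
  - by rewrite subUset sub1set vS; apply: subset_trans sA _; apply/subsetP => x; rewrite !inE => /and3P[].
  - have vA x : x \in A -> ~~ adj v x by move/(subsetP sA); rewrite !inE => /andP[].
    apply/independentP => x y; rewrite !inE => /predU1P[->|xA] /predU1P[->|yA].
    + by rewrite adj_irrefl.
    + by rewrite vA.
    + by rewrite adj_sym vA.
    + exact: indA.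
  - by rewrite cardsU1 cA; case: (boolP (v \in A)) => // /(subsetP sA); rewrite !inE eqxx andbF.
by right; exists A; split=> //; apply: subset_trans sA _; apply/subsetP => x; rewrite !inE => /and3P[].
Qed.

(** * Bicliques in tree decompositions *)

(** Without such a [t], a path in [Y] could always be prolonged without closing a cycle, and would
    outgrow [T]. *)
Lemma acyclic_leaf (T : sgraph) (Y : {set T}) : acyclic T -> Y != set0 ->
  exists2 t, t \in Y & forall x y, x \in Y -> y \in Y -> adj t x -> adj t y -> x = y.
Proof.
move=> acT /set0Pn[t0 t0Y]; apply: contrapT => noleaf.
(* [head t p] is the previous vertex of the path; for empty [p] it is [t], which excludes no
   neighbour. *)
have branch t p : t \in Y -> exists2 x, x \in Y & adj t x && (x != head t p).
  move=> tY; apply: contrapT => nbr; apply: noleaf; exists t => // x y xY yY tx ty.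
  have hd z : z \in Y -> adj t z -> z = head t p.
    move=> zY tz; apply/eqP/negPn/negP => zp; apply: nbr; exists z => //.
    by rewrite tz.
  by rewrite (hd x) // (hd y).
have long n : exists t p, [/\ path adj t p, uniq (t :: p), all (mem Y) (t :: p) & size p = n].
  elim: n => [|n [t [p [tp up pY <-]]]]; first by exists t0, [::]; rewrite /= t0Y.
  have [y yY /andP[ty yp]] := branch t p (allP pY t (mem_head _ _)).
  exists y, (t :: p); split; rewrite //= 1?adj_sym ?ty //; last by rewrite yY.
  rewrite -/(uniq (t :: p)) up andbT; apply/negP; rewrite in_cons => /predU1P[yt|].
    by rewrite yt adj_irrefl in ty.
  (* As [y] is not the first vertex of [p], the segment from [t] to [y] has at least three vertices
     and closes into a cycle. *)
  move=> /splitPr def_p; case: {p}_ / def_p tp up pY yp => -[|a p1] p2 tp up pY yp.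
    by rewrite eqxx in yp.
  apply: (acT (t :: rcons (a :: p1) y)); first by rewrite /= size_rcons.
  move: tp up; rewrite -cat_rcons cat_path -cat_cons cat_uniq => /andP[tp _] /andP[up _].
  by rewrite /ucycle up andbT /cycle rcons_path tp last_rcons adj_sym.
have [t [p [_ /card_uniqP up _ sp]]] := long #|T|.
by have := max_card (mem (t :: p)); rewrite up /= sp ltnn.
Qed.

(** Expresses connectivity of the subtree of [v] on [T] itself, with no subtype of nodes. *)
Definition bag_adj (T : sgraph) (V : finType) (bag : T -> {set V}) (v : V) : rel T :=
  [rel x y | [&& adj x y, v \in bag x & v \in bag y]].

(* Delete leaf bags one by one: either the leaf bag adds nothing to its
   neighbour, or it contains a vertex that occurs in no other bag, and then it
   contains the whole opposite side. *)
Lemma biclique_bag (T : sgraph) (V : finType) (A : {set V}) (bag : T -> {set V}) :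
  acyclic T ->
  (forall v x y, v \in bag x -> v \in bag y -> connect (bag_adj bag v) x y) ->
  (forall u v, u \in A -> v \notin A -> exists2 t, u \in bag t & v \in bag t) ->
  A != set0 -> ~: A != set0 ->
  exists t, A \subset bag t \/ ~: A \subset bag t.
Proof.
move=> acT + + /set0Pn[a0 a0A] /set0Pn[b0 b0A]; rewrite inE in b0A.
have [n] := ubnP #|[set t | bag t != set0]|; elim: n bag => // n IHn bag.
rewrite ltnS => cardY conn cover.
pose Y := [set t | bag t != set0].
have inY t v : v \in bag t -> t \in Y by rewrite inE => vt; apply/set0Pn; exists v.
have Y0 : Y != set0.
  by have [t /inY tY _] := cover a0 b0 a0A b0A; apply/set0Pn; exists t.
have [t tY leaf] := acyclic_leaf acT Y0.
have [[v vt vonly]|dom] := pselect (exists2 v, v \in bag t &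
    forall t', adj t t' -> v \notin bag t').
  (* A path from [t] within the subtree of [v] would first step to a neighbour of [t]. *)
  have v_t t' : v \in bag t' -> t' = t.
    move=> /(conn v t t' vt) /connectP[[|x p] //= /andP[/and3P[tx _ vx]]].
    by rewrite (negPf (vonly x tx)) in vx.
  exists t; case: (boolP (v \in A)) => vA; [right|left]; apply/subsetP => u.
    by rewrite inE => uA; have [t' /v_t->] := cover v u vA uA.
  by move=> uA; have [t' + /v_t E] := cover u v uA vA; rewrite E.
have {}dom v : v \in bag t -> exists2 t', adj t t' & v \in bag t'.
  move=> vt; apply: contrapT => nv; apply: dom; exists v => // t' tt'.
  by apply/negP => vt'; apply: nv; exists t'.
(* Emptying the bag instead of deleting the node keeps [T] fixed; the number of nonempty bags
   drops. *)
pose bag' x := if x == t then set0 else bag x.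
have mem_bag' v x : (v \in bag' x) = (x != t) && (v \in bag x).
  by rewrite /bag'; case: eqP; rewrite ?inE.
have [||| x xP] := IHn bag'.
- apply: leq_trans cardY; apply: proper_card; apply/properP; split.
    by apply/subsetP => x; rewrite !inE /bag'; case: (x == t); rewrite ?eqxx.
  by exists t; rewrite // !inE /bag' !eqxx.
- move=> v x y; rewrite !mem_bag' => /andP[xt vx] /andP[yt vy].
  have /connectP[p0 /shortenP[p xp up _] lastp {p0}] := conn v x y vx vy.
  apply/connectP; exists p => //.
  (* A simple path through [t] would enter and leave by two distinct neighbours with nonempty bags,
     against the choice of [t]. *)
  have tp : t \notin x :: p.
    rewrite in_cons eq_sym (negPf xt) /=; apply/negP => /splitPr def_p.
    case: {p}_ / def_p xp up lastp => p1 [|z p2].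
      by move=> _ _; rewrite last_cat /= => yE; rewrite yE eqxx in yt.
    move=> xp up _; move: xp; rewrite cat_path /= => /and3P[_ /and3P[lt lv tv] /andP[/and3P[tz _ zv] _]].
    have lz : last x p1 = z by apply: leaf (inY _ _ lv) (inY _ _ zv) _ tz; rewrite adj_sym.
    move: up; rewrite -cat_cons cat_uniq => /and3P[_ /hasPn/(_ z)].
    by rewrite in_cons mem_head orbT -lz /= mem_last => /(_ isT).
  rewrite -(@eq_in_path _ (predC1 t) (bag_adj bag v)) //.
    by move=> a b; rewrite !inE /bag_adj /= !mem_bag' => -> ->.
  by apply/allP => z zp; apply: contraNneq tp => <-.
- move=> u v uA vA; have [x ux vx] := cover u v uA vA.
  have [xt|xt] := eqVneq x t; last by exists x; rewrite mem_bag' xt.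
  rewrite {}xt in ux vx; have [y ty uy] := dom u ux; have [z tz vz] := dom v vx.
  have yz := leaf y z (inY _ _ uy) (inY _ _ vz) ty tz; rewrite -yz in vz.
  have yt : y != t by apply/eqP => yE; rewrite yE adj_irrefl in ty.
  by exists y; rewrite mem_bag' yt.
- have sub : bag' x \subset bag x by rewrite /bag'; case: eqP; rewrite ?sub0set.
  by exists x; case: xP => xP; [left|right]; apply: subset_trans sub.
Qed.

Lemma td_bag_connect (G : sgraph) (D : tree_decomposition G) v x y :
  v \in td_bag D x -> v \in td_bag D y -> connect (bag_adj (td_bag D) v) x y.
Proof.
move=> vx vy; pose W := [set t | v \in td_bag D t].
have xW : x \in W by rewrite inE.
have yW : y \in W by rewrite inE.
have /connectP[p] := td_connectedP (exist _ x xW : induced W) (exist _ y yW).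
elim: p x xW {vx} => [|[z zW] p IHp] x xW /=.
  by move=> _ /(congr1 val) /= ->.
move=> /andP[xz zp] lastp; apply: connect_trans (IHp z zW zp lastp).
by move: (xW) (zW); rewrite !inE => vx vz; apply: connect1; apply/and3P.
Qed.

(** The bags are pulled back along [h], with the left side of the biclique as [A]. *)
Lemma td_biclique_bag (G : sgraph) (D : tree_decomposition G) s
  (h : complete_bipartite s s -> G) : 0 < s -> injective h ->
  (forall x y, adj x y -> adj (h x) (h y)) -> exists t, s <= #|td_bag D t|.
Proof.
move=> s0 h_inj hE; pose i0 := Ordinal s0.
pose A : {set 'I_s + 'I_s} := inl @: setT.
have inlA i : inl i \in A by apply: imset_f; rewrite inE.
have inrA i : inr i \notin A by apply/imsetP => -[].
pose bag t := [set x | h x \in td_bag D t].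
have bagE v : bag_adj bag v =2 bag_adj (td_bag D) (h v) by move=> x y; rewrite /bag_adj /= !inE.
have [||||| t tP] := @biclique_bag (td_tree D) _ A bag.
- by case: (td_treeP D).
- by move=> v x y; rewrite !inE (eq_connect (bagE v)); apply: td_bag_connect.
- move=> [i|i] [j|j]; rewrite ?inlA ?(negPf (inrA _)) // => _ _.
  have /td_edgeP : adj (h (inl i)) (h (inr j)) by apply: hE.
  by move=> /(_ D)[t [it jt]]; exists t; rewrite inE.
- by apply/set0Pn; exists (inl i0).
- by apply/set0Pn; exists (inr i0); rewrite inE.
have cA : #|A| = s by rewrite card_imset ?cardsT ?card_ord //; apply: inl_inj.
have cCA : #|~: A| = s.
  by have := cardsC A; rewrite cA card_sum !card_ord => /addnI.
exists t; rewrite -[s]cA; case: tP => sub; last rewrite cA -cCA.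
all: apply: leq_trans (subset_leq_card sub) _; rewrite -(card_imset _ h_inj).
all: by apply/subset_leq_card/subsetP => _ /imsetP[x + ->]; rewrite inE.
Qed.

(** A clique has at most one vertex on each side. *)
Lemma clique_number_bipartite (G : sgraph) m n :
  iso G (complete_bipartite m n) -> clique_number G <= 2.
Proof.
move=> [f [f_bij fE]]; apply/bigmax_leqP => A /cliqueP clA.
pose side x := if f x is inl _ then true else false.
rewrite -card_bool -(@card_in_imset _ _ side A) ?max_card // => x y xA yA sxy.
apply/eqP/negPn/negP => /(clA x y xA yA); rewrite -fE; move: sxy; rewrite /side.
by case: (f x); case: (f y).
Qed.

Lemma tw_omega_bounded_free (C : graph_class) : tw_omega_bounded C ->
  exists2 s, 0 < s & forall H, C H -> free (complete_bipartite s s) H.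
Proof.
(* The sum covers the clique numbers 0, 1 and 2; the two extra units pay for the predecessor in the
   width and for strictness. *)
move=> [f fP]; pose s := (f 0 + f 1 + f 2).+2.
exists s => // H CH [X isoX]; have := fP H CH X.
have := clique_number_bipartite isoX; set w := clique_number _ => le2.
have {le2} fw : f w <= f 0 + f 1 + f 2 by case: w le2 => [|[|[|]]] //; lia.
have [D <-] := ex_treewidth (induced X).
have [f' [[g fK gK] gE]] := isoX.
have [t] : exists t, s <= #|td_bag D t|.
  apply: (@td_biclique_bag _ D s g) => //; first exact: can_inj gK.
  by move=> x y xy; rewrite -gE !gK.
have := leq_bigmax (F := fun t => #|td_bag D t|) t.
by rewrite /td_width /s; lia.
Qed.

(** * From tree-independence number to treewidth *)

Section RestrictDecomposition.
Variables (G : sgraph) (D : tree_decomposition G) (X : {set G}).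

Definition restrict_bag (t : td_tree D) : {set induced X} :=
  [set x | val x \in td_bag D t].

Fact restrict_connected (v : induced X) :
  connected (induced [set t | v \in restrict_bag t]).
Proof.
suff -> : [set t | v \in restrict_bag t] = [set t | val v \in td_bag D t].
  exact: td_connectedP.
by apply/setP => t; rewrite !inE.
Qed.

Definition restrict_decomposition : tree_decomposition (induced X).
Proof.
apply: (@TreeDecomposition (induced X) (td_tree D) restrict_bag (td_treeP D)).
- by move=> v; have [t vt] := td_vertexP D (val v); exists t; rewrite inE.
- move=> u v uv; have [t [ut vt]] := td_edgeP D uv.
  by exists t; rewrite !inE.
- exact: restrict_connected.
Defined.

End RestrictDecomposition.

Lemma bounded_tree_independence_tw_omega (C : graph_class) :
  bounded_tree_independence C -> tw_omega_bounded C.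
Proof.
move=> [k kP]; exists (fun w => 2 ^ (k.+1 + w.+1)) => G CG X.
have [D Dk] := ex_tree_independence G; have := kP G CG; rewrite -Dk => lek.
apply: leq_trans (treewidth_le (restrict_decomposition D X)) _.
apply: leq_trans (leq_pred _) _; apply/bigmax_leqP => t _.
rewrite leqNgt; apply/negP => /ltnW.
(* The image of the restricted bag lies both in a bag of [D], which limits its independent sets, and
   in [X], which limits its cliques. *)
rewrite -[#|_|]card_val_imset => /ramsey[[A [sA indA cA]]|[A [sA clA cA]]].
  suff : #|A| <= k by rewrite cA ltnn.
  have /independence_induced_leP : independence_number (induced (td_bag D t)) <= k.
    by apply: leq_trans lek; apply: (leq_bigmax (F := fun t => independence_number (induced (td_bag D t)))).
  apply=> //; apply: subset_trans sA _.
  by apply/subsetP => _ /imsetP[x + ->]; rewrite inE.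
suff /card_clique_induced : A \subset X by move/(_ clA); rewrite cA ltnn.
by apply: subset_trans sA _; apply/subsetP => _ /imsetP[x _ ->]; apply: (valP x).
Qed.

(** * Star decompositions from vertex covers *)

Section StarDecomposition.
Variables (G : sgraph) (X : {set G}).

(** A star with centre [None] and one leaf per vertex of [G]; the middle [!=] is exclusive or. *)
Definition hub_adj : rel (option G) := fun x y => (x == None) != (y == None).

Fact hub_sym : symmetric hub_adj.
Proof. by move=> x y; rewrite /hub_adj eq_sym. Qed.

Fact hub_irrefl : irreflexive hub_adj.
Proof. by move=> x; rewrite /hub_adj eqxx. Qed.

Definition hub : sgraph := SGraph hub_sym hub_irrefl.

Definition hub_bag (t : hub) : {set G} := if t is Some v then v |: X else X.

Fact hub_connect (x y : hub) (P : {set hub}) (xP : x \in P) (yP : y \in P) :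
  None \in P -> connect (@adj (induced P)) (exist _ x xP) (exist _ y yP).
Proof.
move=> oP.
have toNone z (zP : z \in P) :
    connect (@adj (induced P)) (exist _ z zP) (exist _ None oP).
  case: z zP => [z|] zP; first exact: connect1.
  by rewrite (bool_irrelevance zP oP) connect0.
apply: connect_trans (toNone x xP) _.
by rewrite sym_connect_sym ?toNone //; apply: adj_sym.
Qed.

Fact hub_tree : is_tree hub.
Proof.
split; first by rewrite card_option.
- have toNone (x : hub) : connect adj x None.
    by case: x => [x|]; [apply: connect1 | apply: connect0].
  move=> x y; apply: connect_trans (toNone x) _.
  by rewrite sym_connect_sym ?toNone //; apply: adj_sym.
(* A cycle alternates between [None] and leaves: three nodes cannot, and four consecutive ones
   contain [None] twice. *)
- by move=> [|[a|] [|[b|] [|[d|] [|[e|] c]]]] // _; rewrite /ucycle /= ?inE ?andbF.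
Qed.

Fact hub_edge u v : vertex_cover X -> adj u v ->
  exists t, u \in hub_bag t /\ v \in hub_bag t.
Proof.
move=> cov /cov[uX|vX]; [exists (Some v)|exists (Some u)]; rewrite !inE eqxx.
  by rewrite uX orbT.
by rewrite vX orbT.
Qed.

(** For [v] in [X] these nodes include the centre; otherwise [Some v] is the only one. *)
Fact hub_bag_connected v : connected (induced [set t | v \in hub_bag t]).
Proof.
move=> [x xP] [y yP].
have [vX|vX] := boolP (v \in X); first by apply: hub_connect; rewrite ?inE.
have onlyv z : z \in [set t | v \in hub_bag t] -> z = Some v.
  by rewrite inE; case: z => [z|] /=; rewrite ?inE (negPf vX) // orbF => /eqP->.
suff -> : exist _ x xP = exist _ y yP :> induced [set t | v \in hub_bag t].
  exact: connect0.
by apply: val_inj; rewrite /= (onlyv x) // (onlyv y).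
Qed.

Definition hub_decomposition (cov : vertex_cover X) : tree_decomposition G :=
  @TreeDecomposition G hub hub_bag hub_tree
    (fun v => ex_intro _ (Some v) (setU11 v X))
    (fun u v => @hub_edge u v cov) hub_bag_connected.

(** Each bag has at most one vertex outside [X], hence the extra unit. *)
Lemma vertex_cover_tree_independence s : vertex_cover X ->
  independence_number (induced X) <= s -> tree_independence_number G <= s.+1.
Proof.
move=> cov /independence_induced_leP indX.
apply: leq_trans (tree_independence_le (hub_decomposition cov)) _.
apply/bigmax_leqP => -[v|] _; apply/independence_induced_leP => A sA indA.
  rewrite (cardsD1 v) -add1n; apply: leq_add; first by case: (v \in A).
  apply: indX; first by rewrite subDset.
  by apply/independentP => x y; rewrite !inE => /andP[_ xA] /andP[_ yA]; exact: (independentP _ indA).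
by apply: leqW; apply: indX.
Qed.

End StarDecomposition.

(** * Complements of line graphs *)

Lemma edge_setP (G : sgraph) (e : {set G}) :
  reflect (exists x y, adj x y /\ e = [set x; y]) (e \in edge_set G).
Proof.
rewrite inE; apply: (iffP existsP) => [[x /existsP[y /andP[xy /eqP->]]]|].
  by exists x, y.
by move=> [x [y [xy ->]]]; exists x; apply/existsP; exists y; rewrite xy /=.
Qed.

(** Each side of the biclique is sent to the edges of one star: these share the centre, while edges
    of different stars are disjoint. *)
Lemma co_line_free_two_stars_free (G : sgraph) s :
  free (complete_bipartite s s) (complement (line_graph G)) ->
  subgraph_free (two_stars s) G.
Proof.
move=> freeG /ex_subgraph_iso[h h_inj hE]; apply: freeG; apply/ex_induced_iso.
pose center (x : complete_bipartite s s) : two_stars s :=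
  match x with inl _ => inl (inl ord0) | inr _ => inr (inl ord0) end.
pose leaf (x : complete_bipartite s s) : two_stars s :=
  match x with inl i => inl (inr i) | inr i => inr (inr i) end.
have edgeP x : [set h (center x); h (leaf x)] \in edge_set G.
  apply/edge_setP; exists (h (center x)), (h (leaf x)); split=> //.
  by apply: hE; case: x.
pose phi x : complement (line_graph G) :=
  exist (fun e => e \in edge_set G) _ (edgeP x).
have phi_inj : injective phi.
  (* Among these edges, only that of [x] contains [h (leaf x)]. *)
  move=> x y /(congr1 val) /= /setP/(_ (h (leaf x))).
  rewrite !inE eqxx orbT !(inj_eq h_inj); case: x => i; case: y => j //=.
    by move/esym/eqP => [->].
  by move/esym/eqP => [->].
exists phi => // x y.
rewrite /= /compl_adj /= /line_adj (inj_eq phi_inj) negb_and negbK andb_orr andNb /=.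
have [-> |xy] := eqVneq x y; first by rewrite bip_irrefl.
rewrite negbK setI_eq0 disjoints_subset subUset !sub1set !inE !(inj_eq h_inj) /=.
by case: x y {xy} => i [j|j].
Qed.

Lemma ex_inj_ord (T : finType) (B : {set T}) s : s <= #|B| ->
  exists2 g : 'I_s -> T, injective g & forall i, g i \in B.
Proof.
move=> leB; exists (fun i => enum_val (widen_ord leB i)) => [i j|i].
  by move=> /enum_val_inj /(congr1 val) /= /val_inj.
exact: enum_valP.
Qed.

Lemma two_stars_free_degree (G : sgraph) s (x v : G) :
  subgraph_free (two_stars s) G -> x != v ->
  #|[set u | adj x u]| <= #|[set u | adj v u]| ->
  #|[set u | adj x u] :\ v| <= 2 * s.
Proof.
move=> freeG xv le_deg; rewrite leqNgt; apply/negP => big; apply: freeG.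
have /ex_inj_ord[g g_inj gP] : s <= #|[set u | adj x u] :\ v| by lia.
have cg : #|g @: setT| = s by rewrite card_imset // cardsT card_ord.
(* The degree of [v] is at least that of [x], hence at least [2 * s + 1]; discarding [x] and the [s]
   leaves in [g] leaves at least [s]. *)
have /ex_inj_ord[k k_inj kP] : s <= #|([set u | adj v u] :\ x) :\: (g @: setT)|.
  have := cardsD1 x [set u | adj v u]; have := cardsD1 v [set u | adj x u].
  have := cardsID (g @: setT) ([set u | adj v u] :\ x).
  have := subset_leq_card (subsetIr ([set u | adj v u] :\ x) (g @: setT)).
  by rewrite cg; case: (x \in _); case: (v \in _) => /=; lia.
have {gP} [gv gx] : (forall i, g i != v) /\ forall i, adj x (g i).
  by split=> i; have := gP i; rewrite !inE => /andP[].
have {kP} [[kx kv] kg] : ((forall i, k i != x) /\ forall i, adj v (k i)) /\ forall i j, g i != k j.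
  split; first by split=> i; have := kP i; rewrite !inE => /and3P[].
  move=> i j; have := kP j; rewrite !inE => /andP[+ _].
  by apply: contraNneq => <-; apply: imset_f; rewrite inE.
have gnx i : g i != x by apply: contraTneq (gx i) => ->; rewrite adj_irrefl.
have knv i : k i != v by apply: contraTneq (kv i) => ->; rewrite adj_irrefl.
pose h (z : two_stars s) : G := match z with
  | inl (inl _) => x | inl (inr i) => g i | inr (inl _) => v | inr (inr i) => k i end.
have h_inj : injective h.
  move=> [[a|a]|[a|a]] [[b|b]|[b|b]] /=; first
    [ by rewrite (ord1 a) (ord1 b) | by move/g_inj-> | by move/k_inj->
    | by move=> /eqP E; exfalso; move: E; apply/negP; first [done | rewrite eq_sym] ].
apply/ex_subgraph_iso; exists h => //.
by move=> [[a|a]|[a|a]] [[b|b]|[b|b]] //= _; rewrite 1?adj_sym.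
Qed.

(** An edge at [x] avoiding [v] is determined by its other end, a neighbour of [x] other than
    [v]. *)
Lemma edges_at_le_degree (G : sgraph) (v x : G) (A : {set complement (line_graph G)}) :
  (forall e, e \in A -> v \notin val e) ->
  #|[set e in A | x \in val e]| <= #|[set u | adj x u] :\ v|.
Proof.
move=> Av; rewrite -(card_imset _ val_inj).
apply: leq_trans (leq_imset_card (fun z => [set x; z]) _).
apply/subset_leq_card/subsetP => _ /imsetP[e + ->]; rewrite inE => /andP[eA xe].
have /edge_setP[a [b [ab eE]]] := valP e; have := Av e eA.
move: xe; rewrite eE !inE negb_or => /orP[/eqP->|/eqP->] /andP[va vb].
  by apply/imsetP; exists b; rewrite // !inE eq_sym vb.
by apply/imsetP; exists a; rewrite 1?setUC // !inE eq_sym va adj_sym.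
Qed.

(* Take for the cover all edges of G that avoid a vertex v of maximum degree. *)
Lemma two_stars_free_cover (G : sgraph) s : subgraph_free (two_stars s) G ->
  exists X : {set complement (line_graph G)},
    vertex_cover X /\ independence_number (induced X) <= 4 * s.
Proof.
(* A graph with no vertices has no edges, and the empty cover works. *)
move=> freeG; have [v0 _|G0] := pickP G; last first.
  have noedge (e : complement (line_graph G)) : False.
    by have /edge_setP[x] := valP e; have := G0 x.
  exists set0; split=> [x|]; first by case: (noedge x).
  by apply/independence_induced_leP => A; rewrite subset0 => /eqP->; rewrite cards0.
pose deg (u : G) := #|[set w | adj u w]|.
have [v _ vmax] := arg_maxnP deg (isT : xpredT v0).
exists [set e : complement (line_graph G) | v \notin val e]; split=> [e f /= /andP[ef]|].
  rewrite /= /line_adj ef /= negbK !inE => /eqP/setP/(_ v).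
  by rewrite !inE => /negbT; rewrite negb_and => /orP.
apply/independence_induced_leP => A /subsetP sA /independentP indA.
have [->|[e eA]] := set_0Vmem A; first by rewrite cards0.
have Av f : f \in A -> v \notin val f by move/sA; rewrite inE.
have /edge_setP[x [y [xy eE]]] := valP e.
have := Av e eA; rewrite eE !inE negb_or => /andP[vx vy].
have degle z : v != z -> #|[set f in A | z \in val f]| <= 2 * s.
  move=> vz; apply: leq_trans (edges_at_le_degree z Av) _.
  by apply: two_stars_free_degree => //; [rewrite eq_sym | apply: vmax].
(* Independence in the complement makes every member of [A] meet [e], at [x] or at [y]; each end
   accounts for at most [2 * s] members. *)
have sub : A \subset [set f in A | x \in val f] :|: [set f in A | y \in val f].
  apply/subsetP => f fA; rewrite !inE fA /=.
  have [<-|ef] := eqVneq e f; first by rewrite eE !inE eqxx.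
  have := indA e f eA fA; rewrite /= /compl_adj ef /= /line_adj ef /= negbK.
  by move=> /set0Pn[z]; rewrite eE !inE => /andP[/orP[/eqP->|/eqP->] ->]; rewrite ?orbT.
apply: leq_trans (subset_leq_card sub) _.
rewrite cardsU (mulnDl 2 2 s); apply: leq_trans (leq_subr _ _) _.
by apply: leq_add; apply: degle.
Qed.

Theorem theorem1p7 (C : graph_class) :
  [<-> tw_omega_bounded (co_line_class C);
       bounded_tree_independence (co_line_class C);
       exists2 s : nat, 0 < s &
         forall H : sgraph, co_line_class C H -> free (complete_bipartite s s) H;
       exists2 s : nat, 0 < s &
         forall H : sgraph, co_line_class C H ->
           exists X : {set H},
             vertex_cover X /\ independence_number (induced X) <= s;
       exists2 s : nat, 0 < s &
         forall G : sgraph, C G -> subgraph_free (two_stars s) G].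
Proof.
have P13 := @tw_omega_bounded_free (co_line_class C).
have P21 := @bounded_tree_independence_tw_omega (co_line_class C).
have P35 : (exists2 s, 0 < s & forall H, co_line_class C H -> free (complete_bipartite s s) H) ->
    exists2 s, 0 < s & forall G, C G -> subgraph_free (two_stars s) G.
  move=> [s s0 freeH]; exists s => // G CG; apply: co_line_free_two_stars_free.
  by apply: freeH; exists G.
have P54 : (exists2 s, 0 < s & forall G, C G -> subgraph_free (two_stars s) G) ->
    exists2 s, 0 < s & forall H, co_line_class C H -> exists X : {set H},
      vertex_cover X /\ independence_number (induced X) <= s.
  move=> [s s0 freeG]; exists (4 * s) => [|H [G [CG ->]]]; first by rewrite muln_gt0.
  exact/two_stars_free_cover/freeG.
have P42 : (exists2 s, 0 < s & forall H, co_line_class C H -> exists X : {set H},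
      vertex_cover X /\ independence_number (induced X) <= s) ->
    bounded_tree_independence (co_line_class C).
  move=> [s s0 coverH]; exists s.+1 => H /coverH[X [cov indX]].
  exact: vertex_cover_tree_independence cov indX.
(* The implications form the cycle 1, 3, 5, 4, 2, 1. *)
by tfae; auto.
Qed.
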